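(* Let $s>1$ and $0\le c<\tfrac12$, and let $h_{RL}$ be the function on $[0,1]$ that vanishes outside $(c,1)$ and is given, for $\omega\in(c,1)$, by $$h_{RL}(\omega)=(s-1)(1-c)(1-2c)^s\,[(\omega-c)(1-\omega)]^{s-2}\,\bigl[(\omega-c)^s+(1-2c)^s(1-\omega)^s\bigr]^{\frac1s-2}.$$ For $x,y>0$ let $$V_{RL}(x,y)=\int_0^1\max[\omega x,(1-\omega)y]\,h_{RL}(\omega)\,d\omega .$$ Then for all $x,y>0$ $$V_{RL}(x,y)=\begin{cases} x & \text{if } 0<\frac{y}{x+y}\le c,\\[4pt] \frac{1}{1-c}\Bigl(\bigl\{[(1-c)y-cx]^s+(1-2c)^s x^s\bigr\}^{\frac1s}+cx\Bigr) & \text{if } c<\frac{y}{x+y}<1.\end{cases}$$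
   Context: $h_{RL}$ is the density of the restricted logistic measure on $[0,1]$ (the measure has no atoms), and $V_{RL}$ is the exponential measure function of the corresponding bivariate extreme value distribution for minima with exponential margins, i.e. the joint survivor function is $\Pr(X>x,Y>y)=\exp[-V_{RL}(x,y)]$. *)

(* Defs.v *)
From mathcomp Require Import all_boot all_order all_algebra.
From mathcomp Require Import all_classical all_reals all_analysis.

Set Implicit Arguments.
Unset Strict Implicit.
Unset Printing Implicit Defensive.

Import Order.TTheory GRing.Theory Num.Theory.
Import numFieldNormedType.Exports.

Local Open Scope classical_set_scope.
Local Open Scope ring_scope.

(* All the bases of the real powers [`^] are positive for c < w < 1. *)
Definition h_RL (R : realType) (s c w : R) : R :=
  if c < w < 1 then
    (s - 1) * (1 - c) * (1 - 2 * c) `^ s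
    * ((w - c) * (1 - w)) `^ (s - 2)
    * ((w - c) `^ s + (1 - 2 * c) `^ s * (1 - w) `^ s) `^ (1 / s - 2)
  else 0.

(* Extended-real valued because h_RL is unbounded near c and 1 when s < 2:
   an equation with a real value then includes integrability. *)
Definition V_RL (R : realType) (s c x y : R) : \bar R :=
  (\int[@lebesgue_measure R]_(w in `[0%R, 1%R])
     (Num.max (w * x) ((1 - w) * y) * h_RL s c w)%:E)%E.

(* Main.v *)
Require Import Defs.
From mathcomp Require Import all_boot all_order all_algebra.
From mathcomp Require Import all_classical all_reals all_analysis.
From mathcomp Require Import measurable_realfun.
From mathcomp Require Import ring lra.

Set Implicit Arguments.
Unset Strict Implicit.
Unset Printing Implicit Defensive.

Import Order.TTheory GRing.Theory Num.Theory.
Import numFieldNormedType.Exports.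

Local Open Scope classical_set_scope.
Local Open Scope ring_scope.

(** Write a = 1 - c, k = 1 - 2 c, u = w - c, v = 1 - w, so that u + v = a, and
    D = u ^ s + k ^ s v ^ s ([rl_norm]).  The proof rests on two explicit
    primitives on ]c, 1[, [rl_prim_onem] and [rl_prim_subc]:

      P = u ^ (s - 1) D ^ (1/s - 1)           with P' = v h_RL,
      Q = - k ^ s v ^ (s - 1) D ^ (1/s - 1)   with Q' = u h_RL.

    Up to sign they are the partial derivatives, in u and in v, of the
    logistic function D ^ (1/s), which is homogeneous of degree 1; Euler's
    identity therefore gives u P - v Q = D ^ (1/s).  Their boundary values are
    P(c) = 0, P(1) = 1, Q(c) = - k and Q(1) = 0.

    The maximum of w x and (1 - w) y switches at t = y / (x + y), and on each
    side of t it is a combination A v + B u: the right branch is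
    w x = (x c / a) v + (x / a) u, and the left one is y v.  Thus
    [integral_linear_h_RL], applied on ]c, 1[ when t <= c and on ]c, t[ and
    ]t, 1[ otherwise, evaluates V_RL from the values of P and Q at c, t and 1.
    When t <= c the boundary values leave x.  When c < t they leave
    ((a y - c x) P(t) - x Q(t) + c x) / a; since a y - c x = (x + y) u(t) and
    x = (x + y) v(t), Euler's identity turns the first two terms into the
    announced 1/s-th power.

    As h_RL is unbounded near c and 1 when s < 2, the fundamental theorem of
    calculus is needed in an improper form, [ge0_FTC2_oo]. *)

(** * The fundamental theorem of calculus on an open interval *)

(** The integrand may blow up at both ends: by monotone convergence, the
    integral is the limit of the integrals over compact subintervals, where
    [continuous_FTC2] applies, and F is continuous up to the ends. *)
Lemma ge0_FTC2_oo (R : realType) (f F : R -> R) (a b : R) : a < b ->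
  {in `]a, b[, continuous f} -> {in `]a, b[, forall x, 0 <= f x} ->
  derivable_oo_LRcontinuous F a b -> {in `]a, b[, F^`()%classic =1 f} ->
  (\int[@lebesgue_measure R]_(x in `]a, b[) (f x)%:E = (F b - F a)%:E)%E.
Proof.
move=> ab cf f0 dF F'f.
pose e (n : nat) : R := (b - a) / 2 * n.+2%:R^-1.
have ba0 : 0 < (b - a) / 2 by rewrite divr_gt0// subr_gt0.
have e0 n : 0 < e n by rewrite mulr_gt0// invr_gt0.
have e1 n : e n < (b - a) / 2.
  by rewrite /e -[ltRHS]mulr1 ltr_pM2l// invf_lt1// ltr1n.
have eS m n : (m <= n)%N -> e n <= e m.
  by move=> mn; rewrite ler_pM2l// lef_pV2 ?posrE// ler_nat !ltnS.
have cvge : e @ \oo --> (0 : R).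
  rewrite -(mulr0 ((b - a) / 2)); apply: cvgMr.
  by have := @cvg_harmonic R; rewrite -(cvg_shiftS _).
pose E n : set R := `[a + e n, b - e n]%classic.
have EI n : (E n `<=` `]a, b[)%classic.
  move=> x; rewrite /E/= !in_itv/= => /andP[h1 h2].
  by have := e0 n; lra.
have intE n : (\int[@lebesgue_measure R]_(x in E n) (f x)%:E
    = (F (b - e n) - F (a + e n))%:E)%E.
  have h : a + e n < b - e n by have := e1 n; lra.
  have := e0 n => e0n.
  rewrite (@continuous_FTC2 _ f F) ?EFinB//.
  - apply: continuous_in_subspaceT => x /[!inE]/= /EI.
    exact: cf.
  - apply: derivable_oo_continuousW dF => //.
    apply: (@subset_trans _ _ _ _ (@EI n)); exact: subset_itv_oo_cc.
  - move=> x xab; apply: F'f; apply: (EI n); rewrite /E/=.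
    by apply: subset_itv_oo_cc xab.
have EU : (\bigcup_n E n = `]a, b[)%classic.
  apply/seteqP; split=> [x [n _ /EI]//|x /=]; rewrite in_itv/= => /andP[ax xb].
  have d0 : 0 < Num.min (x - a) (b - x) by rewrite lt_min !subr_gt0 ax.
  have /cvgr0Pnorm_lt/(_ _ d0)[n _ /(_ n (leqnn n))] := cvge.
  rewrite gtr0_norm// lt_min => /andP[h1 h2].
  exists n => //; rewrite /E/= in_itv/=; lra.
have cvgI : (\int[@lebesgue_measure R]_(x in E n) (f x)%:E @[n --> \oo]
    --> \int[@lebesgue_measure R]_(x in \bigcup_n E n) (f x)%:E)%E.
  apply: ge0_nondecreasing_set_cvg_integral.
  - move=> m n mn; apply/subsetPset => x.
    rewrite /E/= !in_itv/= => /andP[h1 h2].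
    by have := eS _ _ mn; lra.
  - by move=> n; exact: measurable_itv.
  - move=> n; apply/measurable_EFinP.
    apply: (measurable_funS _ (@EI n)); first exact: measurable_itv.
    by apply: open_continuous_measurable_fun => // x /[!inE]; exact: cf.
  - by move=> n x /EI xab; rewrite lee_fin; exact: f0.
rewrite (funext intE) EU in cvgI.
have [_ Fa Fb] := dF.
apply: (cvg_unique _ cvgI) => //.
apply: cvg_EFin; first by near=> n.
apply: cvgB.
- move/cvg_at_leftP : Fb; apply; split.
    by move=> n; rewrite ltrBlDr ltrDl.
  by rewrite -[X in _ --> X]subr0; apply: cvgB => //; exact: cvg_cst.
- move/cvg_at_rightP : Fa; apply; split.
    by move=> n; rewrite ltrDl.
  by rewrite -[X in _ --> X]addr0; apply: cvgD => //; exact: cvg_cst.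
Unshelve. all: by end_near. Qed.

(** * Limits and derivatives of real powers *)

Lemma continuous_powR (R : realType) (p u : R) : 0 < u ->
  {for u, continuous (@powR R ^~ p)}.
Proof.
move=> u0; apply/differentiable_continuous/derivable1_diffP.
by have [] := @is_derive1_powR R p u u0.
Qed.

(** The power function itself is not continuous at 0, since [powR] is 1 at
    negative bases; the absolute value makes a two-sided statement true. *)
Lemma continuous_norm_powR (R : realType) (p : R) : 0 < p ->
  continuous (fun u : R => `|u| `^ p).
Proof.
move=> p0 u; have [->|u0] := eqVneq u 0; last first.
  apply: (@continuous_comp _ _ _ (fun u : R => `|u|) (@powR R ^~ p)).
    exact: norm_continuous.
  by apply: continuous_powR; rewrite normr_gt0.
rewrite /continuous_at normr0 powR0 ?gt_eqF//; apply/cvgr0Pnorm_lt => e e0.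
have d0 : 0 < e `^ p^-1 by exact: powR_gt0.
near=> x.
have xd : `|x| < e `^ p^-1.
  near: x; exact: (@cvgr0_norm_lt _ _ _ _ _ id).
rewrite ger0_norm ?powR_ge0//.
have -> : e = (e `^ p^-1) `^ p by rewrite -powRrM mulVf ?gt_eqF// powRr1// ltW.
by apply: gt0_ltr_powR; rewrite ?nnegrE ?powR_ge0.
Unshelve. all: by end_near. Qed.

Lemma cvg_powR_pos (R : realType) (T : Type) (F : set_system T) (FF : Filter F)
    (f : T -> R) (p l : R) :
  0 < l -> f x @[x --> F] --> l -> f x `^ p @[x --> F] --> l `^ p.
Proof.
move=> l0 fl; apply: (@cvg_comp _ _ _ f (@powR R ^~ p) _ _ _ fl).
exact: continuous_powR.
Qed.

Lemma cvg_powR_nneg (R : realType) (T : Type) (F : set_system T)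
    (FF : Filter F) (f : T -> R) (p l : R) :
  0 < p -> 0 <= l -> (\forall x \near F, 0 <= f x) ->
  f x @[x --> F] --> l -> f x `^ p @[x --> F] --> l `^ p.
Proof.
move=> p0 l0 f0 fl.
have := @cvg_comp _ _ _ f (fun u => `|u| `^ p) _ _ _ fl
  (@continuous_norm_powR R p p0 l).
rewrite /= ger0_norm//; apply: cvg_trans; apply: near_eq_cvg.
by near do rewrite /= ger0_norm//.
Unshelve. all: by end_near. Qed.

Lemma powRS (R : realType) (u p : R) : 0 < u -> u `^ p = u * u `^ (p - 1).
Proof.
move=> u0; rewrite -[X in X * _]powRr1 ?ltW// -powRD ?(gt_eqF u0) ?implybT//.
by rewrite addrC subrK.
Qed.

Lemma is_derive_subr_powR (R : realType) (p d w : R) : d < w ->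
  is_derive w 1 (fun x => (x - d) `^ p) (p * (w - d) `^ (p - 1)).
Proof.
rewrite -subr_gt0 => u0.
have H := is_derive1_powR p u0.
have H2 : is_derive w 1 (fun x : R => x - d) 1.
  by apply: is_derive_eq; ring.
have := @is_derive1_comp R (@powR R ^~ p) (fun x => x - d) w _ _ H H2.
by rewrite mulr1.
Qed.

Lemma is_derive_rsub_powR (R : realType) (p d w : R) : w < d ->
  is_derive w 1 (fun x => (d - x) `^ p) (- (p * (d - w) `^ (p - 1))).
Proof.
rewrite -subr_gt0 => u0.
have H := is_derive1_powR p u0.
have H2 : is_derive w 1 (fun x : R => d - x) (-1).
  by apply: is_derive_eq; ring.
have := @is_derive1_comp R (@powR R ^~ p) (fun x => d - x) w _ _ H H2.
by rewrite mulrN1.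
Qed.

(** * Primitives of the restricted logistic density *)

Section logistic.
Variables (R : realType) (s c : R).

(** The s-th power of the l^s norm of (w - c, (1 - 2 c) (1 - w)). *)
Definition rl_norm (w : R) :=
  (w - c) `^ s + (1 - 2 * c) `^ s * (1 - w) `^ s.

(** A primitive of (1 - w) h_RL(w), by [is_derive_rl_prim_onem]. *)
Definition rl_prim_onem (w : R) :=
  (w - c) `^ (s - 1) * rl_norm w `^ (1 / s - 1).

(** A primitive of (w - c) h_RL(w), by [is_derive_rl_prim_subc]. *)
Definition rl_prim_subc (w : R) :=
  - ((1 - 2 * c) `^ s * (1 - w) `^ (s - 1) * rl_norm w `^ (1 / s - 1)).

Lemma rl_norm_gt0 w : c < 1 / 2 -> c <= w <= 1 -> 0 < rl_norm w.
Proof.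
move=> hc /andP[cw w1]; rewrite /rl_norm.
have := powR_ge0 (w - c) s; have := powR_ge0 (1 - w) s => h1 h2.
have k0 : 0 < (1 - 2 * c) `^ s by apply: powR_gt0; lra.
have [E|cw'] := eqVneq w c.
  by rewrite ltr_wpDl// mulr_gt0// powR_gt0//; lra.
rewrite ltr_pwDl//; first by rewrite powR_gt0// subr_gt0 lt_neqAle eq_sym cw'.
by rewrite mulr_ge0// ltW.
Qed.

Lemma is_derive_rl_norm_powR p w : c < 1 / 2 -> c < w < 1 ->
  is_derive w 1 (fun x => rl_norm x `^ p)
    (p * rl_norm w `^ (p - 1) *
    (s * (w - c) `^ (s - 1) - (1 - 2 * c) `^ s * (s * (1 - w) `^ (s - 1)))).
Proof.
move=> hc /andP[cw w1].
have n0 : 0 < rl_norm w by apply: rl_norm_gt0; lra.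
have Hu := is_derive_subr_powR s cw.
have Hv := is_derive_rsub_powR s w1.
have H : is_derive w 1 rl_norm
    (s * (w - c) `^ (s - 1) - (1 - 2 * c) `^ s * (s * (1 - w) `^ (s - 1))).
  by rewrite /rl_norm; apply: is_derive_eq; rewrite /GRing.scale/=; ring.
have Hp := is_derive1_powR p n0.
exact: (@is_derive1_comp R (@powR R ^~ p) rl_norm w _ _ Hp H).
Qed.

(** With u = w - c, v = 1 - w, k = 1 - 2 c and D = [rl_norm] w, factoring
    D ^ (1/s - 2) out of the product rule leaves
    (s - 1) u ^ (s - 2) (D - u (u ^ (s - 1) - k ^ s v ^ (s - 1))), in which the
    powers u ^ s cancel and u + v = 1 - c comes out as a factor. *)
Lemma is_derive_rl_prim_onem w : 1 < s -> c < 1 / 2 -> c < w < 1 ->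
  is_derive w 1 rl_prim_onem ((1 - w) * h_RL s c w).
Proof.
move=> hs hc hw; have /andP[cw w1] := hw; rewrite /h_RL hw -/(rl_norm w).
have Hu := is_derive_subr_powR (s - 1) cw.
have HD := is_derive_rl_norm_powR (1 / s - 1) hc hw.
rewrite /rl_prim_onem; apply: is_derive_eq; rewrite /GRing.scale/=.
have s0 : s != 0 by lra.
have u0 : 0 < w - c by lra.
have v0 : 0 < 1 - w by lra.
have n0 : 0 < rl_norm w by apply: rl_norm_gt0; lra.
(* Every power is reduced to an exponent s - 2 or 1/s - 2, times a monomial,
   so that the identity becomes one of rational functions. *)
have E1 : 1 / s - 1 - 1 = 1 / s - 2 by ring.
have E2 : s - 1 - 1 = s - 2 by ring.
rewrite (powRS (1 / s - 1) n0) E1 powRM ?ltW//.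
rewrite {2}/rl_norm (powRS s u0) (powRS s v0).
rewrite (powRS (s - 1) u0) (powRS (s - 1) v0) E2.
by field.
Qed.

(** The computation for [rl_prim_onem] with the roles of u = w - c and
    v = 1 - w exchanged: now the powers v ^ s cancel. *)
Lemma is_derive_rl_prim_subc w : 1 < s -> c < 1 / 2 -> c < w < 1 ->
  is_derive w 1 rl_prim_subc ((w - c) * h_RL s c w).
Proof.
move=> hs hc hw; have /andP[cw w1] := hw; rewrite /h_RL hw -/(rl_norm w).
have Hv := is_derive_rsub_powR (s - 1) w1.
have HD := is_derive_rl_norm_powR (1 / s - 1) hc hw.
rewrite /rl_prim_subc; apply: is_derive_eq; rewrite /GRing.scale/=.
have s0 : s != 0 by lra.
have u0 : 0 < w - c by lra.
have v0 : 0 < 1 - w by lra.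
have n0 : 0 < rl_norm w by apply: rl_norm_gt0; lra.
have E1 : 1 / s - 1 - 1 = 1 / s - 2 by ring.
have E2 : s - 1 - 1 = s - 2 by ring.
rewrite (powRS (1 / s - 1) n0) E1 powRM ?ltW//.
rewrite {2}/rl_norm (powRS s u0) (powRS s v0).
rewrite (powRS (s - 1) u0) (powRS (s - 1) v0) E2.
by field.
Qed.

Lemma cvg_within_subr_powR p w : 0 < p -> c <= w <= 1 ->
  (x - c) `^ p @[x --> within [set` `[c, 1]] (nbhs w)] --> (w - c) `^ p.
Proof.
move=> p0 /andP[cw w1]; apply: cvg_powR_nneg => //; first by rewrite subr_ge0.
  rewrite near_withinE; apply: nearW => x /=.
  by rewrite in_itv/= subr_ge0 => /andP[].
by apply: cvg_within_filter; apply: cvgB => //; exact: cvg_cst.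
Qed.

Lemma cvg_within_rsub_powR p w : 0 < p -> c <= w <= 1 ->
  (1 - x) `^ p @[x --> within [set` `[c, 1]] (nbhs w)] --> (1 - w) `^ p.
Proof.
move=> p0 /andP[cw w1]; apply: cvg_powR_nneg => //; first by rewrite subr_ge0.
  rewrite near_withinE; apply: nearW => x /=.
  by rewrite in_itv/= subr_ge0 => /andP[].
by apply: cvg_within_filter; apply: cvgB => //; exact: cvg_cst.
Qed.

Lemma cvg_within_rl_norm_powR p w : 1 < s -> c < 1 / 2 -> c <= w <= 1 ->
  rl_norm x `^ p @[x --> within [set` `[c, 1]] (nbhs w)] --> rl_norm w `^ p.
Proof.
move=> hs hc hw; apply: cvg_powR_pos; first exact: rl_norm_gt0.
have s0 : 0 < s by lra.
apply: cvgD; first exact: cvg_within_subr_powR.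
by apply: cvgMr; exact: cvg_within_rsub_powR.
Qed.

(** Both primitives extend continuously to the closed interval because
    s - 1 > 0 and [rl_norm] does not vanish there. *)
Lemma within_continuous_rl_prim (A B : R) : 1 < s -> c < 1 / 2 ->
  {within `[c, 1],
    continuous (fun w => A * rl_prim_onem w + B * rl_prim_subc w)}.
Proof.
move=> hs hc; apply/subspace_continuousP => w /=; rewrite in_itv/= => hw.
have s1 : 0 < s - 1 by lra.
apply: cvgD; apply: cvgMr.
  by apply: cvgM; [exact: cvg_within_subr_powR|exact: cvg_within_rl_norm_powR].
apply: cvgN; apply: cvgM; last exact: cvg_within_rl_norm_powR.
by apply: cvgMr; exact: cvg_within_rsub_powR.
Qed.

Lemma continuous_h_RL : c < 1 / 2 ->
  {in `]c, 1[, continuous (h_RL s c)}.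
Proof.
move=> hc w; rewrite in_itv/= => hw; have /andP[cw w1] := hw.
rewrite /continuous_at {2}/h_RL hw.
have n0 : 0 < rl_norm w by apply: rl_norm_gt0; lra.
have cf : (s - 1) * (1 - c) * (1 - 2 * c) `^ s
   * ((x - c) * (1 - x)) `^ (s - 2) * rl_norm x `^ (1 / s - 2) @[x --> w]
   --> (s - 1) * (1 - c) * (1 - 2 * c) `^ s
   * ((w - c) * (1 - w)) `^ (s - 2) * rl_norm w `^ (1 / s - 2).
  have Hu : (x - c) @[x --> w] --> (w - c).
    by apply: cvgB => //; exact: cvg_cst.
  have Hv : (1 - x) @[x --> w] --> (1 - w).
    by apply: cvgB => //; exact: cvg_cst.
  apply: cvgM.
    apply: cvgMr; apply: cvg_powR_pos; first by rewrite mulr_gt0// subr_gt0.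
    exact: cvgM.
  apply: cvg_powR_pos => //; apply: cvgD.
    by apply: cvg_powR_pos; rewrite ?subr_gt0.
  by apply: cvgMr; apply: cvg_powR_pos; rewrite ?subr_gt0.
apply: cvg_trans cf; apply: near_eq_cvg.
near=> x; rewrite /h_RL ifT//; near: x.
have : w \in `]c, 1[ by rewrite in_itv.
by move=> /near_in_itvoo; apply: filterS => x; rewrite in_itv.
Unshelve. all: by end_near. Qed.

Lemma h_RL_ge0 w : 1 < s -> c < 1 / 2 -> 0 <= h_RL s c w.
Proof.
move=> hs hc; rewrite /h_RL; case: ifP => // /andP[cw w1].
by rewrite !mulr_ge0 ?powR_ge0//; lra.
Qed.

(** Every linear weight is of the form A (1 - w) + B (w - c); nonnegative
    coefficients make the integrand nonnegative on ]c, 1[. *)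
Lemma integral_linear_h_RL (A B p q : R) : 1 < s -> c < 1 / 2 ->
  0 <= A -> 0 <= B -> c <= p -> p < q -> q <= 1 ->
  (\int[@lebesgue_measure R]_(w in `]p, q[)
     ((A * (1 - w) + B * (w - c)) * h_RL s c w)%:E
   = (A * (rl_prim_onem q - rl_prim_onem p)
      + B * (rl_prim_subc q - rl_prim_subc p))%:E)%E.
Proof.
move=> hs hc A0 B0 cp pq q1.
pose G w := A * rl_prim_onem w + B * rl_prim_subc w.
have dG w : c < w < 1 ->
    is_derive w 1 G ((A * (1 - w) + B * (w - c)) * h_RL s c w).
  move=> hw; have HP := is_derive_rl_prim_onem hs hc hw.
  have HQ := is_derive_rl_prim_subc hs hc hw.
  by rewrite /G; apply: is_derive_eq; rewrite /GRing.scale/=; ring.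
have c1 : c < 1 by lra.
have -> : A * (rl_prim_onem q - rl_prim_onem p)
    + B * (rl_prim_subc q - rl_prim_subc p) = G q - G p.
  (* Abstracting the values keeps [ring] from comparing them by unfolding. *)
  rewrite /G; move: (rl_prim_onem p) (rl_prim_onem q) => Pp Pq.
  by move: (rl_prim_subc p) (rl_prim_subc q) => Qp Qq; ring.
apply: ge0_FTC2_oo => //.
- move=> w; rewrite in_itv/= => /andP[pw wq].
  apply: cvgM; last by apply: continuous_h_RL => //; rewrite in_itv/=; lra.
  apply: cvgD; apply: cvgMr.
    by apply: cvgB => //; exact: cvg_cst.
  by apply: cvgB => //; exact: cvg_cst.
- move=> w; rewrite in_itv/= => /andP[pw wq].
  by rewrite mulr_ge0 ?h_RL_ge0// addr_ge0// mulr_ge0//; lra.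
- apply: (@derivable_oo_continuousW _ _ c 1) => //.
    by move=> w /=; rewrite !in_itv/= => /andP[pw wq]; lra.
  have [_ Gc G1] := (continuous_within_itvP _ c1).1
    (@within_continuous_rl_prim A B hs hc).
  split; [|exact: Gc|exact: G1].
  by move=> w; rewrite in_itv/= => /dG[].
- move=> w; rewrite in_itv/= => /andP[pw wq].
  have hw : c < w < 1 by lra.
  by have [_] := dG _ hw; rewrite derive1E.
Qed.

Lemma rl_prim_onemc : 1 < s -> rl_prim_onem c = 0.
Proof.
by move=> hs; rewrite /rl_prim_onem subrr powR0 ?mul0r// subr_eq0 gt_eqF.
Qed.

Lemma rl_prim_subc1 : 1 < s -> rl_prim_subc 1 = 0.
Proof.
move=> hs; rewrite /rl_prim_subc subrr powR0 ?mulr0 ?mul0r ?oppr0//.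
by rewrite subr_eq0 gt_eqF.
Qed.

Lemma rl_prim_onem1 : 1 < s -> c < 1 / 2 -> rl_prim_onem 1 = 1.
Proof.
move=> hs hc; have s0 : s != 0 by lra.
have c0 : 1 - c != 0 by lra.
rewrite /rl_prim_onem /rl_norm subrr powR0// mulr0 addr0 -powRrM.
rewrite -powRD ?c0 ?implybT//.
by rewrite (_ : s - 1 + _ = 0) ?powRr0//; field.
Qed.

Lemma rl_prim_subcc : 1 < s -> c < 1 / 2 -> rl_prim_subc c = - (1 - 2 * c).
Proof.
move=> hs hc; have s0 : s != 0 by lra.
have c0 : 1 - c != 0 by lra.
have k0 : 1 - 2 * c != 0 by lra.
have kn : 0 <= 1 - 2 * c by lra.
have cn : 0 <= 1 - c by lra.
rewrite /rl_prim_subc /rl_norm subrr powR0// add0r powRM ?powR_ge0// -!powRrM.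
rewrite mulrACA -!powRD ?c0 ?k0 ?implybT//.
rewrite (_ : s + _ = 1); last by field.
rewrite (_ : s - 1 + _ = 0); last by field.
by rewrite powRr0 powRr1// mulr1.
Qed.

(** Euler's identity for [rl_norm] w ^ (1/s) as a function of u = w - c and
    v = 1 - w, homogeneous of degree 1 in (u, v). *)
Lemma rl_prim_euler w : c < 1 / 2 -> c < w < 1 ->
  (w - c) * rl_prim_onem w - (1 - w) * rl_prim_subc w = rl_norm w `^ (1 / s).
Proof.
move=> hc /andP[cw w1].
have u0 : 0 < w - c by lra.
have v0 : 0 < 1 - w by lra.
have n0 : 0 < rl_norm w by apply: rl_norm_gt0; lra.
rewrite (powRS (1 / s) n0) {1}/rl_norm (powRS s u0) (powRS s v0).
by rewrite /rl_prim_onem /rl_prim_subc; ring.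
Qed.

End logistic.

(** * The exponent measure function *)

Lemma V_RL_oo (R : realType) (s c x y : R) : 0 <= c ->
  V_RL s c x y = (\int[@lebesgue_measure R]_(w in `]c, 1%R[)
     (Num.max (w * x) ((1 - w) * y) * h_RL s c w)%:E)%E.
Proof.
move=> hc0; rewrite /V_RL [LHS]integral_mkcond [RHS]integral_mkcond.
apply: eq_integral => w _; rewrite /patch !mem_setE !in_itv/=.
case: ifPn => [/andP[w0 w1]|]; case: ifPn => //.
  by rewrite /h_RL => /negbTE ->; rewrite mulr0.
by move=> /andP[cw w1] /negP[]; rewrite !ltW//; exact: le_lt_trans cw.
Qed.

Lemma measurable_max_h_RL (R : realType) (s c x y : R) : c < 1 / 2 ->
  measurable_fun `]c, 1[ (fun w => Num.max (w * x) ((1 - w) * y) * h_RL s c w).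
Proof.
move=> hc; apply: measurable_funM.
  apply: measurable_maxr; apply: measurable_funM => //.
  exact: measurable_funB.
apply: open_continuous_measurable_fun => // w /[!inE].
exact: continuous_h_RL.
Qed.

Lemma V_RL_split (R : realType) (s c x y t : R) :
  1 < s -> 0 <= c -> c < 1 / 2 -> 0 <= x -> 0 <= y -> c < t < 1 ->
  (V_RL s c x y =
    \int[@lebesgue_measure R]_(w in `]c, t[)
      (Num.max (w * x) ((1 - w) * y) * h_RL s c w)%:E
    + \int[@lebesgue_measure R]_(w in `]t, 1%R[)
      (Num.max (w * x) ((1 - w) * y) * h_RL s c w)%:E)%E.
Proof.
move=> hs hc0 hc x0 y0 /andP[ct t1]; rewrite V_RL_oo//.
have mf D : D `<=` `]c, 1[ -> measurable_fun D
    (fun w => (Num.max (w * x) ((1 - w) * y) * h_RL s c w)%:E).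
  move=> Dc1; apply/measurable_EFinP.
  by apply: measurable_funS (measurable_max_h_RL s x y hc).
have c1U : `]c, 1[%classic = `]c, t[ `|` `[t, 1[.
  by rewrite (@itv_bndbnd_setU _ _ _ (BLeft t)) ?bnd_simp// ltW.
rewrite c1U ge0_integral_setU//=.
- congr (_ + _)%E; rewrite integral_itv_bndoo//; apply: mf.
  by apply: subset_itvr; rewrite bnd_simp ltW.
- by rewrite -c1U; exact: mf.
- move=> w; rewrite /= !in_itv/= => hw.
  rewrite lee_fin mulr_ge0 ?h_RL_ge0// le_max mulr_ge0//.
  by case: hw => /andP[]; lra.
- apply/disj_setPS => w/= []; rewrite !in_itv/= => /andP[_ h1] /andP[h2 _].
  by move: (lt_le_trans h1 h2); rewrite ltxx.
Qed.

Theorem mainTheorem1 (R : realType) (s c : R)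
    (hs : 1 < s) (hc0 : 0 <= c) (hc : c < 1 / 2)
    (x y : R) (hx : 0 < x) (hy : 0 < y) :
  (0 < y / (x + y) <= c -> V_RL s c x y = x%:E) /\
  (c < y / (x + y) < 1 ->
     V_RL s c x y =
       (1 / (1 - c)
        * ((((1 - c) * y - c * x) `^ s + (1 - 2 * c) `^ s * x `^ s) `^ (1 / s)
           + c * x))%:E).
Proof.
have c1 : c < 1 by lra.
have a0 : 1 - c != 0 by lra.
have xy0 : 0 < x + y by exact: addr_gt0.
(* Each branch is written as the combination of 1 - w and w - c to be
   integrated. *)
have maxr w : y / (x + y) <= w -> Num.max (w * x) ((1 - w) * y)
    = x * c / (1 - c) * (1 - w) + x / (1 - c) * (w - c).
  rewrite ler_pdivrMr// => h; rewrite max_l; first by field.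
  by nra.
have maxl w : w <= y / (x + y) -> Num.max (w * x) ((1 - w) * y)
    = y * (1 - w) + 0 * (w - c).
  rewrite ler_pdivlMr// => h; rewrite max_r; first by ring.
  by nra.
have A0 : 0 <= x * c / (1 - c) by rewrite divr_ge0 ?mulr_ge0//; lra.
have B0 : 0 <= x / (1 - c) by rewrite divr_ge0//; lra.
split=> [/andP[_ tc]|/andP[ct t1]].
  rewrite V_RL_oo//.
  under eq_integral => w.
    rewrite inE/= in_itv/= => /andP[cw _].
    rewrite maxr; last by apply: le_trans tc _; exact: ltW.
    over.
  rewrite integral_linear_h_RL// rl_prim_onem1// rl_prim_onemc//.
  rewrite rl_prim_subc1// rl_prim_subcc//.
  by congr (_%:E); field.
rewrite (V_RL_split _ _ _ (ltW hx) (ltW hy) (t := y / (x + y)))// ?ct//.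
under eq_integral => w.
  rewrite inE/= in_itv/= => /andP[_ wt].
  rewrite maxl; last exact: ltW.
  over.
under [X in (_ + X)%E]eq_integral => w.
  rewrite inE/= in_itv/= => /andP[wt _].
  rewrite maxr; last exact: ltW.
  over.
have t1' := ltW t1; have ct' := ltW ct; have y0 := ltW hy.
rewrite !integral_linear_h_RL// rl_prim_onem1// rl_prim_onemc// rl_prim_subc1//.
rewrite -EFinD; congr (_%:E).
set t := y / (x + y) in ct t1 *.
(* Homogeneity: the arguments of the claimed value are x + y times the
   values of w - c and 1 - w at the switching point w = t. *)
have U : (1 - c) * y - c * x = (x + y) * (t - c) by rewrite /t; field; lra.
have Ex : x = (x + y) * (1 - t) by rewrite /t; field; lra.
have -> : ((1 - c) * y - c * x) `^ s + (1 - 2 * c) `^ s * x `^ s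
    = (x + y) `^ s * rl_norm s c t.
  have t0 : 0 <= t - c by lra.
  have t2 : 0 <= 1 - t by lra.
  rewrite U [in X in _ + X]Ex !powRM ?(ltW xy0)// /rl_norm; ring.
have s0 : s != 0 by lra.
have n0 : 0 < rl_norm s c t by apply: rl_norm_gt0 => //; lra.
rewrite powRM ?powR_ge0 ?ltW// -powRrM (_ : s * (1 / s) = 1); last by field.
rewrite powRr1 ?ltW// -rl_prim_euler ?ct//.
have -> : (x + y)
     * ((t - c) * rl_prim_onem s c t - (1 - t) * rl_prim_subc s c t)
   = ((1 - c) * y - c * x) * rl_prim_onem s c t - x * rl_prim_subc s c t.
  by rewrite mulrBr !mulrA -U -Ex.
by move: (rl_prim_onem s c t) (rl_prim_subc s c t) => P Q; field.
Qed.
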